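(* Let $I\subseteq\mathbb{C}[x_1,\ldots,x_n]$ be a homogeneous prime ideal generated by polynomials of degree at most $d$, and let $\{f_1,\ldots,f_k\}$ be a finite basis of the $d$-th graded component $[I]_d$ of $I$. For $g=(g_{ij})\in M_n(\mathbb{C})$ and each $i=1,\ldots,k$, consider the matrix $$M_i(g):=\begin{pmatrix}\overrightarrow{f_1}&\overrightarrow{f_2}&\ldots&\overrightarrow{f_k}&\overrightarrow{g*f_i}\end{pmatrix}.$$ Then the symmetry Lie algebra $\mathfrak{g}_I$ of $I$ is $$\mathfrak{g}_I=\{g\in M_n(\mathbb{C})\mid \mathrm{rank}(M_i(g))=k\ \text{ for } i=1,\ldots,k\}.$$
   Context: Let $R=\mathbb{C}[x_1,\ldots,x_n]$ with the standard grading; $[R]_d$ is the vector space of homogeneous polynomials of degree $d$ together with $0$, and $[I]_d=I\cap[R]_d$. Fix an order on the monomials of degree $d$ in $R$ (any order works). For $p\in[R]_d$, $\overrightarrow{p}\in\mathbb{C}^{\binom{n+d-1}{d}}$ is the column vector of coefficients of $p$ with respect to the ordered basis of degree-$d$ monomials. The group $\mathrm{GL}_n(\mathbb{C})$ acts on $R$ by $(g\cdot p)(x)=p(g^{-1}x)$, $x=(x_1,\ldots,x_n)^T$. The symmetry Lie group of a homogeneous prime ideal $I$ is $G_I=\{g\in\mathrm{GL}_n(\mathbb{C})\mid g\cdot p\in I\ \text{for all } p\in I\}$, a closed subgroup of $\mathrm{GL}_n(\mathbb{C})$. The symmetry Lie algebra of $I$ is the Lie algebra of $G_I$: $\mathfrak{g}_I=\{g\in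 M_n(\mathbb{C})\mid e^{tg}\in G_I\ \text{for all } t\in\mathbb{R}\}$. The operation $*:M_n(\mathbb{C})\times R\to R$ is $g*p(x)=\frac{d}{dt}\big|_{t=0}(e^{tg}\cdot p(x))$. Equivalently, it is linear in $p$ and determined by: $g*c=0$ for constants $c$; $g*x_i=-\sum_{j=1}^n g_{ij}x_j$; and $g*(p_1p_2)=(g*p_1)p_2+p_1(g*p_2)$. *)

(* Defs.v *)
From HB Require Import structures.
From mathcomp Require Import all_boot all_order all_algebra complex.
From mathcomp Require Import boolp classical_sets reals topology.
(* [normedtype] is imported without its notations: one of them is incompatible
   with a notation of [mpoly]. *)
From mathcomp Require Import -(notations) normedtype.
From mathcomp Require Import sequences mpoly.
Set Implicit Arguments.
Unset Strict Implicit.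
Unset Printing Implicit Defensive.
Import Order.TTheory GRing.Theory Num.Theory.
Import numFieldNormedType.Exports.
Local Open Scope ring_scope.
Local Open Scope classical_set_scope.

(* Packed as a field structure, so that [Cplx R] and the matrices over it
   inherit the norm topology that the library puts on every [numFieldType];
   the bare type [R[i]] carries no topology. *)
Definition Cplx (R : realType) : numClosedFieldType := R[i].

Definition of_real (R : realType) (t : R) : Cplx R := real_complex R t.

Section Ideals.
Variables (R : realType) (n : nat).
Local Notation P := {mpoly (Cplx R)[n]}.

Definition homogeneous_ideal (I : {pred P}) : Prop :=
  forall p (e : nat), p \in I -> pihomog mdeg e p \in I.

Definition ideal_generated_by (S : set P) : set P :=
  [set p | exists (m : nat) (a s : 'I_m -> P),
             (forall i, S (s i)) /\ p = \sum_(i < m) a i * s i].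

(* [msize p <= d.+1] means that [p] has total degree at most [d]. *)
Definition generated_in_degree_le (d : nat) (I : {pred P}) : Prop :=
  exists S : set P, (forall q, S q -> (msize q <= d.+1)%N) /\
                    [set` I] = ideal_generated_by S.

Definition graded_component (I : {pred P}) (d : nat) : set P :=
  [set p | p \in I /\ p \is d.-homog].

Definition is_basis (k : nat) (f : 'I_k -> P) (V : set P) : Prop :=
  [/\ forall i, V (f i),
      forall c : 'I_k -> Cplx R,
        \sum_(i < k) c i *: f i = 0 -> forall i, c i = 0
    & forall p, V p -> exists c : 'I_k -> Cplx R, p = \sum_(i < k) c i *: f i].

End Ideals.

Section SymmetryLieAlgebra.
Variables (R : realType) (n : nat).
Local Notation P := {mpoly (Cplx R)[n]}.
Local Notation M := 'M[Cplx R]_n.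

Definition expmx (A : M) : M :=
  limn (series (fun k : nat => (k`!%:R : Cplx R)^-1 *: A ^+ k)).

(* (g . p)(x) = p (g^-1 x) *)
Definition gl_act (g : M) (p : P) : P :=
  p \mPo [tuple \sum_(j < n) invmx g i j *: 'X_j | i < n].

Definition symmetry_group (I : {pred P}) : set M :=
  [set g | g \in unitmx /\ forall p, p \in I -> gl_act g p \in I].

Definition symmetry_lie_algebra (I : {pred P}) : set M :=
  [set g | forall t : R, symmetry_group I (expmx (of_real t *: g))].

(* Derivative at 0 of a complex-valued function of a real variable. *)
Definition derive_at0 (F : R -> Cplx R) : Cplx R :=
  lim ((of_real h)^-1 * (F h - F 0) @[h --> (0 : R)^']).

(* g * p = d/dt (e^(tg) . p) at t = 0, coefficient by coefficient.  Linear
   substitutions do not raise the degree, so the coefficients of e^(tg) . p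
   vanish identically on the monomials omitted from the sum. *)
Definition lie_act (g : M) (p : P) : P :=
  \sum_(m : 'X_{1..n < msize p})
     derive_at0 (fun t => (gl_act (expmx (of_real t *: g)) p)@_m) *: 'X_[m].

End SymmetryLieAlgebra.

Section CoefficientMatrix.
Variables (R : realType) (n d : nat).
Local Notation P := {mpoly (Cplx R)[n]}.

(* An ordering of the monomials of degree [d] is an enumeration of them without
   repetition. *)
Definition monomial_ordering (mon : 'C((n + d - 1)%N, d).-tuple 'X_{1..n}) :
    Prop :=
  uniq mon /\ forall m : 'X_{1..n}, (m \in mon) = (mdeg m == d).

Definition coef_vec (mon : 'C((n + d - 1)%N, d).-tuple 'X_{1..n}) (p : P) :
    'cV[Cplx R]_('C((n + d - 1)%N, d)) :=
  \col_a p@_(tnth mon a).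

(* The columns are the coefficient vectors of f_1, ..., f_k and g * f_i. *)
Definition basis_action_mx (mon : 'C((n + d - 1)%N, d).-tuple 'X_{1..n})
    (k : nat) (f : 'I_k -> P) (g : 'M[Cplx R]_n) (i : 'I_k) :
    'M[Cplx R]_('C((n + d - 1)%N, d), k + 1) :=
  row_mx (\matrix_(a, j) coef_vec mon (f j) a 0)
         (coef_vec mon (lie_act g (f i))).

End CoefficientMatrix.

(* Main.v *)
Require Import Defs.
From HB Require Import structures.
From mathcomp Require Import all_boot all_order all_algebra complex.
From mathcomp Require Import boolp classical_sets reals topology.
From mathcomp Require Import -(notations) normedtype.
From mathcomp Require Import sequences mpoly.
From mathcomp Require Import -(notations) functions derive realfun exp.
From mathcomp Require Import ring.
Set Implicit Arguments.
Unset Strict Implicit.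
Unset Printing Implicit Defensive.

(** Write [rho t] for the action of [expmx (t g)] on polynomials and [D] for
    the derivation sending [X_i] to [- sum_j g_ij X_j].  The rank of
    [basis_action_mx mon f g i] is [k] exactly when [D f_i] lies in the
    span of the basis [f] ([rank_basis_action_mx]), because the coefficient
    vectors of [f] are linearly independent and [D] preserves the degree.  So
    the theorem says that all [rho t] preserve the ideal if and only if [D]
    preserves the span of [f].

    Everything analytic is contained in the identity
    [d/dt (rho t p) = rho t (D p)] ([is_pderive_gl_act]), read coefficient by
    coefficient.  At [t = 0] it identifies [lie_act g] with [D] ([lie_actE]).

    If every [rho t] preserves the ideal, then the curve [rho t f_i] stays in
    the span of [f], a subspace cut out by linear equations on coefficients;
    differentiating these equations at [0] puts [D f_i] in the span
    ([span_of_gl_act]).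

    Conversely, write [D f_i = sum_j B_ij f_j].  The identity above turns into
    the linear system [y' = B y] with constant coefficients for the functions
    [y_i t = rho t f_i].  Its solution is unique ([linear_ode_unique]), so
    [rho t f_i = sum_j (expmx (t B))_ij f_j] lies in the ideal
    ([gl_act_expmx_span]).  Hence [rho t] maps the forms of degree [d] of the
    ideal into the ideal.  Primality carries this down to forms of degree
    at most [d] ([lin_subst_lower_degree]), among which are the homogeneous
    components of a set of generators ([lin_subst_ideal]).

    The facts about the exponential are obtained by differentiation: its
    entries are everywhere convergent power series in [t], differentiated term by
    term, and [expmx (t g)] is inverted by [expmx (- t g)] because the product
    of the two has derivative zero. *)

Import Order.TTheory GRing.Theory Num.Theory.
Import numFieldNormedType.Exports.
Local Open Scope ring_scope.
Local Open Scope classical_set_scope.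

(** * Derivatives of complex-valued functions of a real variable *)

Section ComplexCurves.
Variable R : realType.
Implicit Types (z w : Cplx R) (F G : R -> Cplx R) (t : R).

Lemma ReD z w : complex.Re (z + w) = complex.Re z + complex.Re w.
Proof. by case: z w => a b [c e]. Qed.
Lemma ImD z w : complex.Im (z + w) = complex.Im z + complex.Im w.
Proof. by case: z w => a b [c e]. Qed.
Lemma ReN z : complex.Re (- z) = - complex.Re z. Proof. by case: z. Qed.
Lemma ImN z : complex.Im (- z) = - complex.Im z. Proof. by case: z. Qed.
Lemma ReM z w :
  complex.Re (z * w) = complex.Re z * complex.Re w - complex.Im z * complex.Im w.
Proof. by case: z w => a b [c e]. Qed.
Lemma ImM z w :
  complex.Im (z * w) = complex.Re z * complex.Im w + complex.Im z * complex.Re w.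
Proof. by case: z => a b; case: w => c d. Qed.
Lemma Re_real (x : R) : complex.Re (of_real x) = x. Proof. by []. Qed.
Lemma Im_real (x : R) : complex.Im (of_real x) = 0. Proof. by []. Qed.

Lemma Cplx_eq z w :
  complex.Re z = complex.Re w -> complex.Im z = complex.Im w -> z = w.
Proof. by case: z => a b; case: w => c d /= -> ->. Qed.

Lemma Re_sum (I : Type) (r : seq I) (P : pred I) (E : I -> Cplx R) :
  complex.Re (\sum_(i <- r | P i) E i) = \sum_(i <- r | P i) complex.Re (E i).
Proof. by apply: (big_morph (fun z : Cplx R => complex.Re z) ReD). Qed.

Lemma Im_sum (I : Type) (r : seq I) (P : pred I) (E : I -> Cplx R) :
  complex.Im (\sum_(i <- r | P i) E i) = \sum_(i <- r | P i) complex.Im (E i).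
Proof. by apply: (big_morph (fun z : Cplx R => complex.Im z) ImD). Qed.

(** The norm of [Cplx R] takes complex values; this compares it with real
    quantities, so that convergence in [Cplx R] reduces to that of both parts. *)
Lemma normC_le_ReIm z : `|z| <= of_real (`|complex.Re z| + `|complex.Im z|).
Proof.
have -> : z = of_real (complex.Re z) + 'i%C * of_real (complex.Im z).
  exact: complexE.
apply: le_trans (ler_normD _ _) _; rewrite normrM.
have hr (x : R) : `|of_real x| = of_real `|x|.
  rewrite /of_real; case: (ger0P x) => hx.
  - by rewrite ger0_norm // ler0c.
  - by rewrite ltr0_norm ?rmorphN // ltcR.
have -> : `|'i%C : Cplx R| = 1.
  by rewrite normc_def /= expr0n expr1n add0r sqrtr1.
by rewrite mul1r !hr /of_real -rmorphD lecR ReD ImD ReM ImM /=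
  ?(mul0r, mul1r, subr0, addr0, add0r).
Qed.

Lemma cvg_Cplx (T : Type) (F : set_system T) (FF : Filter F)
    (f : T -> Cplx R) z :
  complex.Re (f x) @[x --> F] --> complex.Re z ->
  complex.Im (f x) @[x --> F] --> complex.Im z ->
  f @ F --> z.
Proof.
move=> fr fi; apply/cvgrPdist_lt => e e0.
(* A positive complex number is real. *)
have er : e = of_real (complex.Re e).
  by apply: Cplx_eq => //=; apply/eqP; move: e0; rewrite ltcE => /andP[].
have e20 : 0 < complex.Re e / 2.
  by rewrite divr_gt0 //; move: e0; rewrite ltcE => /andP[].
move/cvgrPdist_lt: fr => /(_ _ e20) fr.
move/cvgrPdist_lt: fi => /(_ _ e20) fi.
near=> x.
apply: le_lt_trans (normC_le_ReIm _) _.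
rewrite er ltcR ReD ImD ReN ImN [ltRHS](splitr (complex.Re e)) ltrD //.
- by near: x.
- by near: x.
Unshelve. all: by end_near. Qed.

(** The field [Cplx R] is not a normed module over [R], so differentiability
    along the real line is expressed through the real and imaginary parts. *)
Definition is_cderive F t z :=
  is_derive t 1 (fun s => complex.Re (F s)) (complex.Re z) /\
  is_derive t 1 (fun s => complex.Im (F s)) (complex.Im z).

Lemma is_cderive_cst w t : is_cderive (fun=> w) t 0.
Proof. by split; apply: is_derive_cst. Qed.

Lemma is_cderiveD F G t z w :
  is_cderive F t z -> is_cderive G t w ->
  is_cderive (fun s => F s + G s) t (z + w).
Proof.
move=> [Fr Fi] [Gr Gi]; split.
- rewrite ReD (_ : (fun s => _) =
    (fun s => complex.Re (F s)) + (fun s => complex.Re (G s))).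
    exact: is_deriveD.
  by apply/funext => s; rewrite ReD.
- rewrite ImD (_ : (fun s => _) =
    (fun s => complex.Im (F s)) + (fun s => complex.Im (G s))).
    exact: is_deriveD.
  by apply/funext => s; rewrite ImD.
Qed.

Lemma is_cderiveM F G t z w : is_cderive F t z -> is_cderive G t w ->
  is_cderive (fun s => F s * G s) t (z * G t + F t * w).
Proof.
move=> [Fr Fi] [Gr Gi]; split.
- have H := is_deriveB (is_deriveM Fr Gr) (is_deriveM Fi Gi).
  rewrite (_ : (fun s => _) =
    (fun s => complex.Re (F s)) * (fun s => complex.Re (G s)) -
    (fun s => complex.Im (F s)) * (fun s => complex.Im (G s))); last first.
    by apply/funext => s; rewrite ReM.
  apply: is_derive_eq H _.
  rewrite ReD !ReM /GRing.scale /=.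
  ring.
- have H := is_deriveD (is_deriveM Fr Gi) (is_deriveM Fi Gr).
  rewrite (_ : (fun s => _) =
    (fun s => complex.Re (F s)) * (fun s => complex.Im (G s)) +
    (fun s => complex.Im (F s)) * (fun s => complex.Re (G s))); last first.
    by apply/funext => s; rewrite ImM.
  apply: is_derive_eq H _.
  rewrite ImD !ImM /GRing.scale /=.
  ring.
Qed.

Lemma is_cderive_sum (I : Type) (r : seq I) (P : pred I) (E : I -> R -> Cplx R)
    t (D : I -> Cplx R) :
  (forall i, P i -> is_cderive (E i) t (D i)) ->
  is_cderive (fun s => \sum_(i <- r | P i) E i s) t (\sum_(i <- r | P i) D i).
Proof.
move=> H; elim: r => [|i r IH].
  rewrite big_nil (_ : (fun s => _) = (fun=> 0)); first exact: is_cderive_cst.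
  by apply/funext => s; rewrite big_nil.
rewrite big_cons (_ : (fun s => _) = (fun s => if P i then
   E i s + \sum_(j <- r | P j) E j s else \sum_(j <- r | P j) E j s)); last first.
  by apply/funext => s; rewrite big_cons.
case Pi : (P i) => //.
by apply: is_cderiveD => //; apply: H.
Qed.

Lemma is_cderive_unique F t z w : is_cderive F t z -> is_cderive F t w -> z = w.
Proof.
move=> [[_ Fr] [_ Fi]] [[_ Gr] [_ Gi]].
by apply: Cplx_eq; rewrite -?Fr -?Fi.
Qed.

Lemma is_cderive0_cst F s t : (forall u, is_cderive F u 0) -> F s = F t.
Proof.
move=> H; apply: Cplx_eq.
- by apply: (@is_derive_0_is_cst _ (fun u => complex.Re (F u))) => u; case: (H u).
- by apply: (@is_derive_0_is_cst _ (fun u => complex.Im (F u))) => u; case: (H u).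
Qed.

Lemma is_cderive_at0 F z : is_cderive F 0 z -> derive_at0 F = z.
Proof.
move=> [[dr vr] [di vi]]; rewrite /derive_at0.
apply: cvg_lim; first exact: norm_hausdorff.
have realV (h : R) : (of_real h)^-1 = of_real h^-1 by rewrite /of_real fmorphV.
apply: cvg_Cplx.
- rewrite -vr /derive.
  have -> : (fun h : R => complex.Re ((of_real h)^-1 * (F h - F 0))) =
    (fun h : R => h^-1 *: (complex.Re (F (h *: 1 + 0)) - complex.Re (F 0))).
    apply/funext => h.
    by rewrite realV ReM Re_real Im_real mul0r subr0 ReD ReN addr0 [h *: 1]mulr1.
  exact: dr.
- rewrite -vi /derive.
  have -> : (fun h : R => complex.Im ((of_real h)^-1 * (F h - F 0))) =
    (fun h : R => h^-1 *: (complex.Im (F (h *: 1 + 0)) - complex.Im (F 0))).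
    apply/funext => h.
    by rewrite realV ImM Re_real Im_real mul0r addr0 ImD ImN addr0 [h *: 1]mulr1.
  exact: di.
Qed.

End ComplexCurves.

(** * Real power series with factorially decaying coefficients *)

Section EntireSeries.
Variable R : realType.
Implicit Types (a : nat -> R) (c t : R).

(** A condition stable under termwise differentiation that makes the power series
    converge everywhere. *)
Definition factorial_decay a :=
  exists K c : R, 0 <= c /\ forall k, `|a k| <= K * (c ^+ k / k`!%:R).

Lemma factorial_decay_diffs a :
  factorial_decay a -> factorial_decay (pseries_diffs a).
Proof.
move=> [K [c [c0 ha]]]; exists (K * c), c; split=> // k.
rewrite /pseries_diffs normrM normr_nat.
apply: le_trans (ler_wpM2l _ (ha k.+1)) _; first by rewrite ler0n.
rewrite le_eqVlt; apply/orP; left; apply/eqP.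
rewrite factS natrM exprS invfM.
have : (k.+1%:R : R) != 0 by rewrite pnatr_eq0.
have : (k`!%:R : R) != 0 by rewrite pnatr_eq0 -lt0n fact_gt0.
by move=> k_neq0 kS_neq0; field; rewrite k_neq0 nat1r.
Qed.

Lemma factorial_decay_cvg a t : factorial_decay a -> cvgn (pseries a t).
Proof.
move=> [K [c [c0 ha]]]; rewrite /pseries.
apply: normed_cvg.
apply: (@series_le_cvg _ _ (fun k => K * exp_coeff (c * `|t|) k)).
- by move=> k /=; rewrite normr_ge0.
- move=> k; rewrite /exp_coeff /= mulr_ge0 //.
    by have := le_trans (normr_ge0 _) (ha 0%N); rewrite expr0 fact0 divr1 mulr1.
  by rewrite divr_ge0 ?ler0n // exprn_ge0 // mulr_ge0.
- move=> k; rewrite /exp_coeff /= normrM normrX exprMn.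
  apply: le_trans (ler_wpM2r _ (ha k)) _; first by rewrite exprn_ge0.
  rewrite le_eqVlt; apply/orP; left; apply/eqP.
  by rewrite -!mulrA; congr (_ * (_ * _)); rewrite mulrC.
- exact: is_cvg_seriesZ (is_cvg_series_exp_coeff _).
Qed.

Lemma factorial_decay_derive a t : factorial_decay a ->
  is_derive t 1 (fun x => limn (pseries a x))
    (limn (pseries (pseries_diffs a) t)).
Proof.
move=> ha; have hd := factorial_decay_diffs ha.
(* Any radius larger than [`|t|] would do. *)
apply: (@pseries_snd_diffs _ _ (`|t| + 1)).
- exact: factorial_decay_cvg.
- exact: factorial_decay_cvg.
- exact/factorial_decay_cvg/factorial_decay_diffs.
- by rewrite [X in _ < X]ger0_norm ?addr_ge0 // ltrDl.
Qed.

End EntireSeries.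

(** * The matrix exponential *)

Section MatrixExponential.
Variable R : realType.

Definition is_mderive m n (F : R -> 'M[Cplx R]_(m, n)) t
    (L : 'M[Cplx R]_(m, n)) :=
  forall i j, is_cderive (fun s => F s i j) t (L i j).

Lemma is_mderive_cst m n (A : 'M[Cplx R]_(m, n)) t : is_mderive (fun=> A) t 0.
Proof. by move=> i j; rewrite mxE; apply: is_cderive_cst. Qed.

Lemma is_mderiveM m n p (F : R -> 'M[Cplx R]_(m, n)) (G : R -> 'M[Cplx R]_(n, p))
    t A B : is_mderive F t A -> is_mderive G t B ->
  is_mderive (fun s => F s *m G s) t (A *m G t + F t *m B).
Proof.
move=> hF hG i j; rewrite !mxE -big_split /=.
rewrite (_ : (fun s => _) = (fun s => \sum_k F s i k * G s k j)); last first.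
  by apply/funext => s; rewrite mxE.
by apply: is_cderive_sum => k _; apply: is_cderiveM.
Qed.

Lemma is_mderive0_cst m n (F : R -> 'M[Cplx R]_(m, n)) s t :
  (forall u, is_mderive F u 0) -> F s = F t.
Proof.
move=> H; apply/matrixP => i j.
apply: (is_cderive0_cst (F := fun u => F u i j)) => u.
by have := H u i j; rewrite mxE.
Qed.

Lemma cvg_mx (T : Type) (F : set_system T) (FF : Filter F) m n
    (f : T -> 'M[Cplx R]_(m, n)) (A : 'M[Cplx R]_(m, n)) :
  (forall i j, f x i j @[x --> F] --> A i j) -> f @ F --> A.
Proof.
move=> H B [P AP PB].
have : \forall x \near F, forall i j, P i j (f x i j).
  apply: filter_forall => i; apply: filter_forall => j.
  exact: (H i j _ (AP i j)).
by apply: filterS => x hx; apply: PB.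
Qed.

Variable n : nat.
Implicit Types (g : 'M[Cplx R]_n) (t : R).

(** A real-valued submultiplicative norm on the complex numbers. *)
Let cnorm (z : Cplx R) : R := `|complex.Re z| + `|complex.Im z|.

Let cnorm_sum (I : Type) (r : seq I) (E : I -> Cplx R) :
  cnorm (\sum_(i <- r) E i) <= \sum_(i <- r) cnorm (E i).
Proof.
elim/big_ind2 : _ => //; first by rewrite /cnorm /= normr0 addr0.
move=> x1 x2 y1 y2 h1 h2; apply: le_trans (lerD h1 h2).
by rewrite /cnorm ReD ImD addrACA lerD // ler_normD.
Qed.

Let cnormM (z w : Cplx R) : cnorm (z * w) <= cnorm z * cnorm w.
Proof.
rewrite /cnorm ReM ImM mulrDl !mulrDr -!normrM.
rewrite (le_trans (lerD (ler_normB _ _) (ler_normD _ _))) //.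
by rewrite le_eqVlt; apply/orP; left; apply/eqP; ring.
Qed.

Let expr_entry_bound g : exists2 c : R, 0 <= c &
  forall k i j, cnorm ((g ^+ k) i j) <= c ^+ k.
Proof.
(* The total norm of the entries bounds the norm of each row. *)
exists (\sum_i \sum_j cnorm (g i j)).
  by apply: sumr_ge0 => i _; apply: sumr_ge0 => j _; rewrite /cnorm addr_ge0.
elim=> [|k IH] i j.
  rewrite !expr0 mxE; case: eqP => _ /=.
    by rewrite /cnorm /= normr1 normr0 addr0.
  by rewrite /cnorm /= normr0 addr0.
rewrite exprS mxE; apply: le_trans (cnorm_sum _ _) _.
apply: (@le_trans _ _
  (\sum_l cnorm (g i l) * (\sum_i \sum_j cnorm (g i j)) ^+ k)).
  apply: ler_sum => l _; apply: le_trans (cnormM _ _) _.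
  by apply: ler_wpM2l; [rewrite /cnorm addr_ge0|apply: IH].
rewrite -mulr_suml exprS; apply: ler_wpM2r.
  apply: exprn_ge0.
  by apply: sumr_ge0 => i' _; apply: sumr_ge0 => j' _; rewrite /cnorm addr_ge0.
rewrite [leRHS](bigD1 i) //= lerDl.
by apply: sumr_ge0 => i' _; apply: sumr_ge0 => j' _; rewrite /cnorm addr_ge0.
Qed.

Let re_coef g i j k : R := complex.Re ((g ^+ k) i j) / k`!%:R.
Let im_coef g i j k : R := complex.Im ((g ^+ k) i j) / k`!%:R.

Let decayRe g i j : factorial_decay (re_coef g i j).
Proof.
have [c c0 hc] := expr_entry_bound g; exists 1, c; split=> // k.
rewrite mul1r /re_coef normrM [X in _ * X <= _]ger0_norm ?invr_ge0 ?ler0n //.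
rewrite ler_wpM2r ?invr_ge0 ?ler0n //; apply: le_trans (hc k i j).
by rewrite /cnorm lerDl.
Qed.

Let decayIm g i j : factorial_decay (im_coef g i j).
Proof.
have [c c0 hc] := expr_entry_bound g; exists 1, c; split=> // k.
rewrite mul1r /im_coef normrM [X in _ * X <= _]ger0_norm ?invr_ge0 ?ler0n //.
rewrite ler_wpM2r ?invr_ge0 ?ler0n //; apply: le_trans (hc k i j).
by rewrite /cnorm lerDr.
Qed.

Let expmx_scale (a : Cplx R) g k : (a *: g) ^+ k = a ^+ k *: g ^+ k.
Proof.
elim: k => [|k IH]; first by rewrite !expr0 scale1r.
by rewrite !exprS IH -!mulmxE -scalemxAl -scalemxAr scalerA.
Qed.

Let expmx_partial g t N i j :
  (series (fun k => (k`!%:R : Cplx R)^-1 *: (of_real t *: g) ^+ k) N) i j =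
  \sum_(0 <= k < N) of_real (t ^+ k / k`!%:R) * (g ^+ k) i j.
Proof.
rewrite /series /= summxE; apply: eq_bigr => k _.
rewrite expmx_scale !mxE mulrA; congr (_ * _).
by rewrite /of_real rmorphM fmorphV rmorph_nat rmorphXn /= mulrC.
Qed.

Let expmx_entry g t i j :
  expmx (of_real t *: g) i j =
  Complex (limn (pseries (re_coef g i j) t)) (limn (pseries (im_coef g i j) t)).
Proof.
rewrite /expmx.
set A := \matrix_(i, j) (Complex (limn (pseries (re_coef g i j) t))
  (limn (pseries (im_coef g i j) t)) : Cplx R).
suff -> :
  limn (series (fun k => (k`!%:R : Cplx R)^-1 *: (of_real t *: g) ^+ k)) = A.
  by rewrite mxE.
apply: cvg_lim; first exact: norm_hausdorff.
apply: cvg_mx => i' j'; rewrite /A mxE; apply: cvg_Cplx => /=.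
- rewrite (_ : (fun N => _) = pseries (re_coef g i' j') t).
    exact/factorial_decay_cvg/decayRe.
  apply/funext => N; rewrite expmx_partial Re_sum /pseries /series /=.
  apply: eq_bigr => k _.
  rewrite ReM Re_real Im_real mul0r subr0 /re_coef mulrC -!mulrA; congr (_ * _).
  by rewrite mulrC.
- rewrite (_ : (fun N => _) = pseries (im_coef g i' j') t).
    exact/factorial_decay_cvg/decayIm.
  apply/funext => N; rewrite expmx_partial Im_sum /pseries /series /=.
  apply: eq_bigr => k _.
  rewrite ImM Re_real Im_real mul0r addr0 /im_coef mulrC -!mulrA; congr (_ * _).
  by rewrite mulrC.
Qed.

Let cvg_sum_real (f : 'I_n -> nat -> R) (a : 'I_n -> R) :
  (forall l, f l N @[N --> \oo] --> a l) ->
  (\sum_l f l N) @[N --> \oo] --> \sum_l a l.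
Proof.
move=> H.
apply: (@cvg_big R^o 'I_n +%R 0 predT _ nat \oo (index_enum _) f a) => //.
exact: (@add_continuous R^o).
Qed.

Let expmx_diffs g t i j : Cplx R :=
  Complex (limn (pseries (pseries_diffs (re_coef g i j)) t))
          (limn (pseries (pseries_diffs (im_coef g i j)) t)).

Let expmx_deriv0 g t :
  is_mderive (fun s => expmx (of_real s *: g)) t
    (\matrix_(i, j) expmx_diffs g t i j).
Proof.
move=> i j; rewrite mxE; split.
- rewrite (_ : (fun s => _) = (fun s => limn (pseries (re_coef g i j) s))).
    exact/factorial_decay_derive/decayRe.
  by apply/funext => s; rewrite expmx_entry.
- rewrite (_ : (fun s => _) = (fun s => limn (pseries (im_coef g i j) s))).
    exact/factorial_decay_derive/decayIm.
  by apply/funext => s; rewrite expmx_entry.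
Qed.

(** The differentiated series of an entry of the exponential has coefficients
    [(g ^+ k.+1) i j / k`!].  Peeling one factor off [g ^+ k.+1], on either side,
    gives the hypothesis, and the conclusion is then the corresponding product of
    [g] with the exponential. *)
Let expmx_diffsE g t i j (z : 'I_n -> Cplx R) (a b : 'I_n -> 'I_n) :
  (forall k, (g ^+ k.+1) i j = \sum_l z l * (g ^+ k) (a l) (b l)) ->
  expmx_diffs g t i j = \sum_l z l * expmx (of_real t *: g) (a l) (b l).
Proof.
move=> H.
have cR l := factorial_decay_cvg (t := t) (decayRe g (a l) (b l)).
have cI l := factorial_decay_cvg (t := t) (decayIm g (a l) (b l)).
have k0 k : (k.+1%:R : R) != 0 by rewrite pnatr_eq0.
apply: Cplx_eq; rewrite /= ?Re_sum ?Im_sum.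
- apply: cvg_lim; first exact: Rhausdorff.
  rewrite (_ : pseries _ t = (fun N => \sum_l (
     complex.Re (z l) * pseries (re_coef g (a l) (b l)) t N -
     complex.Im (z l) * pseries (im_coef g (a l) (b l)) t N))); last first.
    apply/funext => N; rewrite /pseries /series /=.
    under [RHS]eq_bigr => l _ do rewrite !mulr_sumr -sumrB.
    rewrite exchange_big /=; apply: eq_bigr => k _.
    rewrite /pseries_diffs /re_coef /im_coef H Re_sum factS natrM invfM.
    rewrite mulrCA mulVKf // !mulr_suml; apply: eq_bigr => l _.
    by rewrite ReM; ring.
  apply: cvg_sum_real => l.
  rewrite ReM expmx_entry /=.
  by apply: cvgB; apply: cvgMl_tmp; [apply: cR|apply: cI].
- apply: cvg_lim; first exact: Rhausdorff.
  rewrite (_ : pseries _ t = (fun N => \sum_l (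
     complex.Re (z l) * pseries (im_coef g (a l) (b l)) t N +
     complex.Im (z l) * pseries (re_coef g (a l) (b l)) t N))); last first.
    apply/funext => N; rewrite /pseries /series /=.
    under [RHS]eq_bigr => l _ do rewrite !mulr_sumr -big_split /=.
    rewrite exchange_big /=; apply: eq_bigr => k _.
    rewrite /pseries_diffs /re_coef /im_coef H Im_sum factS natrM invfM.
    rewrite mulrCA mulVKf // !mulr_suml; apply: eq_bigr => l _.
    by rewrite ImM; ring.
  apply: cvg_sum_real => l.
  rewrite ImM expmx_entry /=.
  by apply: cvgD; apply: cvgMl_tmp; [apply: cI|apply: cR].
Qed.

Lemma is_mderive_expmxl g t :
  is_mderive (fun s => expmx (of_real s *: g)) t (g *m expmx (of_real t *: g)).
Proof.
suff <- : (\matrix_(i, j) expmx_diffs g t i j) = g *m expmx (of_real t *: g).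
  exact: expmx_deriv0.
apply/matrixP => i j; rewrite !mxE.
by apply: expmx_diffsE => k; rewrite exprS mxE.
Qed.

Lemma is_mderive_expmxr g t :
  is_mderive (fun s => expmx (of_real s *: g)) t (expmx (of_real t *: g) *m g).
Proof.
suff <- : (\matrix_(i, j) expmx_diffs g t i j) = expmx (of_real t *: g) *m g.
  exact: expmx_deriv0.
apply/matrixP => i j; rewrite !mxE.
rewrite (@expmx_diffsE g t i j (fun l => g l j) (fun=> i) id).
  by apply: eq_bigr => l _; rewrite mulrC.
by move=> k; rewrite exprSr mxE; apply: eq_bigr => l _; rewrite mulrC.
Qed.

Lemma expmx0 g : expmx (of_real 0 *: g) = 1%:M.
Proof.
rewrite /expmx /of_real rmorph0 scale0r.
apply: cvg_lim; first exact: norm_hausdorff.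
apply: cvg_near_cst; exists 1%N => // -[//|N] _.
rewrite /series /= big_nat_recl //= fact0 invr1 expr0 scale1r.
by rewrite big1 ?addr0 // => k _; rewrite exprS mul0r scaler0.
Qed.

Let mulmx_cancel p (A B : 'M[Cplx R]_n) (C : 'M[Cplx R]_(n, p)) :
  A *m - B *m C + A *m (B *m C) = 0.
Proof. by rewrite mulmxN mulNmx -mulmxA addNr. Qed.

(** Both exponentials commute with [g], so the derivative of the product cancels,
    and the product keeps its value at [0]. *)
Lemma expmxN_mul g t :
  expmx (of_real t *: - g) *m expmx (of_real t *: g) = 1%:M.
Proof.
have -> : 1%:M = expmx (of_real 0 *: - g) *m expmx (of_real 0 *: g).
  by rewrite !expmx0 mul1mx.
have /= := @is_mderive0_cst _ _
  (fun s => expmx (of_real s *: - g) *m expmx (of_real s *: g)) t 0.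
apply=> u.
have := is_mderiveM (is_mderive_expmxr (- g) u) (is_mderive_expmxl g u).
by rewrite mulmx_cancel.
Qed.

Lemma expmx_unit g t : expmx (of_real t *: g) \in unitmx.
Proof. by case: (mulmx1_unit (expmxN_mul g t)). Qed.

Lemma invmx_expmx g t :
  invmx (expmx (of_real t *: g)) = expmx (of_real t *: - g).
Proof.
by rewrite -[LHS]mul1mx -(expmxN_mul g t) mulmxK ?expmx_unit.
Qed.

(** The function [expmx (- t g) *m Y t] has derivative zero. *)
Lemma linear_ode_unique p (g : 'M[Cplx R]_n) (Y : R -> 'M[Cplx R]_(n, p)) t :
  (forall s, is_mderive Y s (g *m Y s)) -> Y t = expmx (of_real t *: g) *m Y 0.
Proof.
move=> hY.
suff <- : expmx (of_real t *: - g) *m Y t = Y 0.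
  by rewrite mulmxA -{1}[g]opprK expmxN_mul mul1mx.
have -> : Y 0 = expmx (of_real 0 *: - g) *m Y 0 by rewrite expmx0 mul1mx.
have /= := @is_mderive0_cst _ _ (fun s => expmx (of_real s *: - g) *m Y s) t 0.
apply=> u.
have := is_mderiveM (is_mderive_expmxr (- g) u) (hY u).
by rewrite mulmx_cancel.
Qed.

End MatrixExponential.

(** * Linear substitutions and the derivations they integrate *)

Section LinearSubstitutions.
Variables (R : realType) (n : nat).
Local Notation P := {mpoly (Cplx R)[n]}.
Local Notation M := 'M[Cplx R]_n.
Implicit Types (A g : M) (p q : P) (t : R).

Definition lin_subst A p : P :=
  p \mPo [tuple \sum_(j < n) A i j *: 'X_j | i < n].

Lemma lin_substX A i : lin_subst A 'X_i = \sum_(j < n) A i j *: 'X_j.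
Proof. by rewrite [LHS]mmapX mmap1U tnth_mktuple. Qed.

Lemma lin_substC A c : lin_subst A c%:MP = c%:MP.
Proof. exact: comp_mpolyC. Qed.

Lemma lin_substD A p q : lin_subst A (p + q) = lin_subst A p + lin_subst A q.
Proof. exact: comp_mpolyD. Qed.

Lemma lin_substN A p : lin_subst A (- p) = - lin_subst A p.
Proof. exact: comp_mpolyN. Qed.

Lemma lin_substZ A c p : lin_subst A (c *: p) = c *: lin_subst A p.
Proof. exact: comp_mpolyZ. Qed.

Lemma lin_subst_sum A (I : Type) (r : seq I) (F : I -> P) :
  lin_subst A (\sum_(i <- r) F i) = \sum_(i <- r) lin_subst A (F i).
Proof. exact: (raddf_sum (comp_mpoly _)). Qed.

Lemma lin_substM A p q : lin_subst A (p * q) = lin_subst A p * lin_subst A q.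
Proof. exact: rmorphM. Qed.

Lemma lin_subst_lin A k (c : 'I_k -> Cplx R) (f : 'I_k -> P) :
  lin_subst A (\sum_j c j *: f j) = \sum_j c j *: lin_subst A (f j).
Proof. by rewrite lin_subst_sum; apply: eq_bigr => j _; rewrite lin_substZ. Qed.

Lemma mcoeff_lin k (c : 'I_k -> Cplx R) (f : 'I_k -> P) (m : 'X_{1..n}) :
  (\sum_j c j *: f j)@_m = \sum_j c j * (f j)@_m.
Proof.
by rewrite (raddf_sum (mcoeff m)); apply: eq_bigr => j _; rewrite /= mcoeffZ.
Qed.

Lemma lin_substXn A p m : lin_subst A (p ^+ m) = lin_subst A p ^+ m.
Proof. exact: (rmorphXn (comp_mpoly _)). Qed.

Lemma lin_subst1 p : lin_subst 1%:M p = p.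
Proof.
apply: etrans (comp_mpoly_id p); rewrite /lin_subst.
suff -> : [tuple \sum_(j < n) (1%:M : M) i j *: 'X_j | i < n] =
    [tuple 'X_i | i < n] :> n.-tuple P by [].
apply: eq_from_tnth => i; rewrite !tnth_mktuple (bigD1 i) //= mxE eqxx scale1r.
by rewrite big1 ?addr0 // => j /negPf ji; rewrite mxE eq_sym ji scale0r.
Qed.

Lemma lin_substXm_homog A (m : 'X_{1..n}) :
  lin_subst A 'X_[m] \is (mdeg m).-homog.
Proof.
rewrite /lin_subst comp_mpolyX mdegE.
elim/big_rec2 : _ => [|i e p _ hp]; first exact: dhomog1.
apply: dhomogM hp; rewrite -[e in e.-homog]mul1n; apply: dhomogMn.
rewrite tnth_mktuple; apply: rpred_sum => j _; apply: rpredZ.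
by rewrite dhomogX; apply/eqP; rewrite /= mdeg1.
Qed.

Lemma lin_substE A p :
  lin_subst A p = \sum_(m <- msupp p) p@_m *: lin_subst A 'X_[m].
Proof. exact: comp_mpolyEX. Qed.

Lemma lin_subst_homog A p d : p \is d.-homog -> lin_subst A p \is d.-homog.
Proof.
move=> /dhomogP hp; rewrite lin_substE big_seq; apply: rpred_sum => m mp.
by apply: rpredZ; rewrite -(hp _ mp); apply: lin_substXm_homog.
Qed.

Lemma lin_subst_msize A p (m : 'X_{1..n}) :
  (msize p <= mdeg m)%N -> (lin_subst A p)@_m = 0.
Proof.
move=> pm; rewrite lin_substE raddf_sum big_seq big1 // => m' /= m'p.
rewrite mcoeffZ (dhomog_nemf_coeff (lin_substXm_homog A m')) ?mulr0 //.
by rewrite neq_ltn (leq_trans (msize_mdeg_lt m'p) pm) orbT.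
Qed.

Definition is_pderive (Q : R -> P) t p :=
  forall m, is_cderive (fun s => (Q s)@_m) t p@_m.

Lemma is_pderive_ext Q Q' t p : Q =1 Q' -> is_pderive Q t p -> is_pderive Q' t p.
Proof. by move=> /funext ->. Qed.

Lemma is_pderive_cst q t : is_pderive (fun=> q) t 0.
Proof. by move=> m; rewrite mcoeff0; apply: is_cderive_cst. Qed.

Lemma is_pderiveD Q Q' t p p' : is_pderive Q t p -> is_pderive Q' t p' ->
  is_pderive (fun s => Q s + Q' s) t (p + p').
Proof.
move=> h h' m; rewrite mcoeffD.
rewrite (_ : (fun s => _) = (fun s => (Q s)@_m + (Q' s)@_m)).
  exact: is_cderiveD.
by apply/funext => s; rewrite mcoeffD.
Qed.

Lemma is_pderiveM Q Q' t p p' : is_pderive Q t p -> is_pderive Q' t p' ->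
  is_pderive (fun s => Q s * Q' s) t (p * Q' t + Q t * p').
Proof.
move=> h h' m; rewrite mcoeffD !mcoeffM -big_split /=.
rewrite (_ : (fun s => _) = (fun s =>
    \sum_(k : 'X_{1..n < (mdeg m).+1, (mdeg m).+1} | m == (k.1 + k.2)%MM)
      ((Q s)@_k.1 * (Q' s)@_k.2))).
  by apply: is_cderive_sum => k _; apply: is_cderiveM.
by apply/funext => s; rewrite mcoeffM.
Qed.

Lemma is_pderiveZ (a : R -> Cplx R) q t b : is_cderive a t b ->
  is_pderive (fun s => a s *: q) t (b *: q).
Proof.
move=> h m; rewrite mcoeffZ (_ : (fun s => _) = (fun s => a s * q@_m)).
  have := is_cderiveM h (is_cderive_cst q@_m t).
  by rewrite mulr0 addr0.
by apply/funext => s; rewrite mcoeffZ.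
Qed.

Lemma is_pderive_sum (I : Type) (r : seq I) (Q : I -> R -> P) t (p : I -> P) :
  (forall i, is_pderive (Q i) t (p i)) ->
  is_pderive (fun s => \sum_(i <- r) Q i s) t (\sum_(i <- r) p i).
Proof.
move=> H; elim: r => [|i r IH].
  rewrite big_nil; apply: is_pderive_ext (is_pderive_cst 0 t) => s.
  by rewrite big_nil.
rewrite big_cons; apply: is_pderive_ext (is_pderiveD (H i) IH) => s.
by rewrite big_cons.
Qed.

(** Polynomials are generated as an algebra by the constants and the variables. *)
Lemma mpoly_alg_ind (S : P -> Prop) :
  (forall c, S c%:MP) -> (forall i, S 'X_i) ->
  (forall p q, S p -> S q -> S (p + q)) ->
  (forall p q, S p -> S q -> S (p * q)) -> forall p, S p.
Proof.
move=> SC SX SD SM p; rewrite [p]mpolyE.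
have S0 : S 0 by rewrite -mpolyC0; apply: (SC).
have S1 : S 1 by rewrite -mpolyC1; apply: SC.
apply: (big_ind S) => // m _; rewrite -mul_mpolyC; apply: (SM) => //.
rewrite mpolyXE_id; apply: (big_ind S S1 SM) => i _.
by elim: (m i) => [|k IH]; rewrite ?expr0 ?exprS //; apply: (SM).
Qed.

Lemma mderiv_var (i j : 'I_n) : 'X_i^`M(j) = ((i == j)%:R : Cplx R)%:MP_[n].
Proof.
rewrite mderivX mnm1E -mul_mpolyC.
case: eqP => [->|_]; last by rewrite mpolyC0 mul0r.
rewrite (_ : (U_(j) - U_(j))%MM = 0%MM) ?mpolyX0 ?mulr1 //.
by apply/mnmP => l; rewrite mnmBE mnm0E subnn.
Qed.

(** The chain rule.  Both sides obey the Leibniz rule in [p], so it suffices to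
    treat constants and variables. *)
Lemma is_pderive_lin_subst (F : R -> M) t A p : is_mderive F t A ->
  is_pderive (fun s => lin_subst (F s) p) t
    (\sum_(i < n) lin_subst (F t) p^`M(i) * \sum_(j < n) A i j *: 'X_j).
Proof.
move=> hF; elim/mpoly_alg_ind : p => [c|i|p q hp hq|p q hp hq].
- rewrite big1 => [|i _]; last first.
    by rewrite mderivC -mpolyC0 lin_substC mpolyC0 mul0r.
  apply: is_pderive_ext (is_pderive_cst c%:MP t) => s.
  by rewrite lin_substC.
- rewrite (bigD1 i) //= [X in _ + X]big1 => [|j /negPf ji]; last first.
    by rewrite mderiv_var eq_sym ji lin_substC mpolyC0 mul0r.
  rewrite mderiv_var eqxx lin_substC mpolyC1 mul1r addr0.
  apply: (@is_pderive_ext (fun s => \sum_(j < n) F s i j *: 'X_j)) => [s|].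
    by rewrite [RHS]lin_substX.
  by apply: is_pderive_sum => j; apply: is_pderiveZ.
- under eq_bigr => i _ do rewrite mderivD lin_substD mulrDl.
  rewrite big_split /=; apply: is_pderive_ext (is_pderiveD hp hq) => s.
  by rewrite lin_substD.
- set Lp := \sum_(i < n) lin_subst (F t) p^`M(i) * _ in hp.
  set Lq := \sum_(i < n) lin_subst (F t) q^`M(i) * _ in hq.
  suff -> : \sum_(i < n) lin_subst (F t) (p * q)^`M(i) *
      \sum_(j < n) A i j *: 'X_j =
      Lp * lin_subst (F t) q + lin_subst (F t) p * Lq.
    by apply: is_pderive_ext (is_pderiveM hp hq) => s; rewrite lin_substM.
  rewrite /Lp /Lq [X in X + _]mulr_suml [X in _ + X]mulr_sumr -big_split.
  apply: eq_bigr => i _ /=.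
  rewrite mderivM lin_substD 2!lin_substM.
  rewrite [LHS]mulrDl; congr (_ + _); first exact: mulrAC.
  exact/esym/mulrA.
Qed.

(** The derivation sending ['X_i] to [- \sum_j g i j *: 'X_j]. *)
Definition lie_deriv g p : P :=
  \sum_(i < n) p^`M(i) * - (\sum_(j < n) g i j *: 'X_j).

(** For [A = expmx (- t g)], whose derivative in [t] is [- g *m A], this turns the
    chain rule into a substitution applied to [lie_deriv g p]. *)
Lemma lin_subst_lie_deriv A g p :
  \sum_(i < n) lin_subst A p^`M(i) * \sum_(j < n) (- g *m A) i j *: 'X_j =
  lin_subst A (lie_deriv g p).
Proof.
rewrite /lie_deriv lin_subst_sum; apply: eq_bigr => i _ /=.
rewrite lin_substM; congr (_ * _).
rewrite lin_substN lin_subst_sum -sumrN.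
rewrite (eq_bigr (fun j => \sum_k (- g i k * A k j) *: 'X_j)) => [|j _];
  last first.
  by rewrite mxE scaler_suml; apply: eq_bigr => k _; rewrite mxE.
rewrite exchange_big; apply: eq_bigr => k _ /=.
rewrite lin_substZ lin_substX scaler_sumr -sumrN.
by apply: eq_bigr => j _; rewrite scalerA mulNr scaleNr.
Qed.

Lemma gl_act_expmx g p t :
  gl_act (expmx (of_real t *: g)) p = lin_subst (expmx (of_real t *: - g)) p.
Proof. by rewrite /gl_act invmx_expmx. Qed.

Lemma gl_act_sum g k (c : 'I_k -> Cplx R) (f : 'I_k -> P) :
  gl_act g (\sum_j c j *: f j) = \sum_j c j *: gl_act g (f j).
Proof. exact: lin_subst_lin. Qed.

(** The flow equation of the one-parameter group generated by [g]. *)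
Lemma is_pderive_gl_act g p t :
  is_pderive (fun s => gl_act (expmx (of_real s *: g)) p) t
    (gl_act (expmx (of_real t *: g)) (lie_deriv g p)).
Proof.
apply: (@is_pderive_ext
  (fun s => lin_subst (expmx (of_real s *: - g)) p)) => [s|].
  by rewrite gl_act_expmx.
have := is_pderive_lin_subst p (is_mderive_expmxl (- g) t).
by rewrite lin_subst_lie_deriv gl_act_expmx.
Qed.

Lemma gl_act_expmx0 g p : gl_act (expmx (of_real 0 *: g)) p = p.
Proof. by rewrite gl_act_expmx expmx0 lin_subst1. Qed.

Lemma gl_act_homog g p d : p \is d.-homog -> gl_act g p \is d.-homog.
Proof. exact: lin_subst_homog. Qed.

Lemma is_pderive_gl_act0 g p :
  is_pderive (fun s => gl_act (expmx (of_real s *: g)) p) 0 (lie_deriv g p).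
Proof.
by rewrite -[lie_deriv g p](gl_act_expmx0 g); apply: is_pderive_gl_act.
Qed.

(** A coefficient that vanishes along the whole orbit has derivative zero. *)
Lemma lie_deriv_vanish g p (m : 'X_{1..n}) :
  (forall A, (lin_subst A p)@_m = 0) -> (lie_deriv g p)@_m = 0.
Proof.
move=> H; apply: is_cderive_unique (is_pderive_gl_act0 g p m) _.
rewrite (_ : (fun s => _) = (fun=> 0)); first exact: is_cderive_cst.
by apply/funext => s; apply: H.
Qed.

Lemma lie_deriv_homog g p d : p \is d.-homog -> lie_deriv g p \is d.-homog.
Proof.
move=> hp; apply/dhomogP => m; rewrite mcoeff_msupp => hm.
apply/eqP; apply: contraNT hm => md; apply/eqP/lie_deriv_vanish => A.
exact: dhomog_nemf_coeff (lin_subst_homog A hp) md.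
Qed.

Lemma lie_actE g p : lie_act g p = lie_deriv g p.
Proof.
apply/mpolyP => m; rewrite /lie_act.
rewrite (eq_bigr (fun m : 'X_{1..n < msize p} =>
    (lie_deriv g p)@_m *: 'X_[m])) => [|m' _].
  case: (ltnP (mdeg m) (msize p)) => hm.
    exact: (mcoeff_mpoly (fun m : 'X_{1..n} => (lie_deriv g p)@_m) hm).
  (* The sum defining [lie_act] omits the monomials of degree [msize p] or more,
     on which the whole orbit vanishes. *)
  rewrite lie_deriv_vanish => [|A]; last exact: lin_subst_msize.
  rewrite raddf_sum big1 // => m' _ /=.
  rewrite mcoeffZ mcoeffX; case: eqP => [m'm|]; last by rewrite mulr0.
  by have := bmdeg m'; rewrite m'm ltnNge hm.
by congr (_ *: _); apply: is_cderive_at0; apply: is_pderive_gl_act0.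
Qed.

End LinearSubstitutions.

(** * Linear substitutions preserving a homogeneous prime ideal *)

Section HomogeneousPrimeIdeals.
Variables (R : realType) (n : nat).
Local Notation P := {mpoly (Cplx R)[n]}.
Local Notation M := 'M[Cplx R]_n.

Lemma idealZr (I : idealr P) (c : Cplx R) (p : P) : p \in I -> c *: p \in I.
Proof. by move=> pI; rewrite -mul_mpolyC; apply: idealMr. Qed.

(** When all the variables are sent into the ideal, the substitution reduces to
    evaluation at the origin modulo the ideal. *)
Lemma lin_subst_congr_const (I : idealr P) (A : M) :
  (forall i, lin_subst A 'X_i \in I) ->
  forall p, lin_subst A p - (p@_0%MM)%:MP \in I.
Proof.
move=> AX; elim/mpoly_alg_ind => [c|i|p q hp hq|p q hp hq].
- by rewrite /lin_subst comp_mpolyC mcoeffC eqxx mulr1 subrr idealr0.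
- rewrite mcoeffX; have /negPf -> : U_(i)%MM != 0%MM.
    apply/eqP => /(congr1 (fun m : 'X_{1..n} => m i)).
    by rewrite mnm1E mnm0E eqxx.
  by rewrite mpolyC0 subr0.
- rewrite /lin_subst comp_mpolyD mcoeffD mpolyCD opprD addrACA.
  exact: rpredD.
- rewrite lin_substM rmorphM /= mpolyCM.
  have mulB (S : comPzRingType) (a b c e : S) :
    a * b - c * e = a * (b - e) + e * (a - c) by ring.
  rewrite mulB.
  by apply: rpredD; apply: idealMr.
Qed.

Lemma dhomog0_const (p : P) : p \is 0.-homog -> p = (p@_0%MM)%:MP.
Proof.
move=> hp; apply/mpolyP => m; rewrite mcoeffC.
have [->|m0] := eqVneq m 0%MM; first by rewrite mulr1.
by rewrite mulr0 (dhomog_nemf_coeff hp) // mdeg_eq0.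
Qed.

(** If some variable ['X_i] is not sent into [I], multiply [p] by a power of
    ['X_i] to reach degree [d], and cancel the image of that power by primality.
    If all variables are sent into [I], then [lin_subst A p] is congruent to the constant
    term of [p], which lies in [I] because [p] is a form. *)
Lemma lin_subst_lower_degree (I : prime_idealr P) (A : M) d e :
  (forall p, p \in I -> p \is d.-homog -> lin_subst A p \in I) -> (e <= d)%N ->
  forall p, p \in I -> p \is e.-homog -> lin_subst A p \in I.
Proof.
move=> hd ed p pI pe.
have [/forallP AX|/forallPn [i AXi]] :=
  boolP [forall i, lin_subst A 'X_i \in I].
  suff p0 : (p@_0%MM)%:MP \in I.
    rewrite -(subrK (p@_0%MM)%:MP (lin_subst A p)).
    by apply: rpredD => //; apply: lin_subst_congr_const.
  case: e ed pe => [|e] _ pe; first by rewrite -dhomog0_const.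
  by rewrite (dhomog_nemf_coeff pe) ?mpolyC0 ?idealr0 //= mdeg0.
have : lin_subst A ('X_i ^+ (d - e) * p) \in I.
  apply: hd; first exact: idealMr.
  rewrite -[d in d.-homog](subnK ed); apply: dhomogM => //.
  rewrite -[(d - e)%N in X in X.-homog]mul1n; apply: dhomogMn.
  by rewrite dhomogX; apply/eqP; rewrite /= mdeg1.
rewrite lin_substM prime_idealrM => /orP[|//].
rewrite lin_substXn => Ik.
case/negP: AXi.
elim: (d - e)%N Ik => [|l IH]; first by rewrite expr0 idealr1.
by rewrite exprS prime_idealrM => /orP[].
Qed.

(** A generator of degree at most [d] is the sum of its homogeneous components,
    which belong to [I] and have degree at most [d]. *)
Lemma lin_subst_ideal (I : prime_idealr P) (A : M) d :
  homogeneous_ideal I -> generated_in_degree_le d I ->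
  (forall p, p \in I -> p \is d.-homog -> lin_subst A p \in I) ->
  forall p, p \in I -> lin_subst A p \in I.
Proof.
move=> Ihomog [S [Sd SI]] hd p pI.
have S_sub s : S s -> s \in I.
  move=> Ss; have : ideal_generated_by S s.
    by exists 1%N, (fun=> 1), (fun=> s); split=> //; rewrite big_ord1 mul1r.
  by rewrite -SI.
have : ideal_generated_by S p by rewrite -SI.
move=> [m [a [s [Ss ->]]]].
rewrite [lin_subst A _]raddf_sum; apply: rpred_sum => i _ /=.
rewrite [_ \mPo _]lin_substM; apply: idealMr.
rewrite (pihomog_partitionE (Sd _ (Ss i))) [lin_subst A _]raddf_sum.
apply: rpred_sum => e _ /=.
apply: (lin_subst_lower_degree hd (e := e)); first by rewrite -ltnS.
  exact/Ihomog/S_sub.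
exact: pihomogP.
Qed.

End HomogeneousPrimeIdeals.

(** * Spans of forms and the rank of the coefficient matrix *)

Section CoefficientRows.
Variables (R : realType) (n d : nat).
Local Notation P := {mpoly (Cplx R)[n]}.
Variable mon : 'C((n + d - 1)%N, d).-tuple 'X_{1..n}.
Hypothesis mon_ord : monomial_ordering mon.
Variables (k : nat) (f : 'I_k -> P).
Hypothesis f_homog : forall i, f i \is d.-homog.

Definition basis_mx : 'M[Cplx R]_(k, 'C((n + d - 1)%N, d)) :=
  \matrix_(j, a) (f j)@_(tnth mon a).

Lemma mul_basis_mx (c : 'rV_k) :
  c *m basis_mx = (coef_vec mon (\sum_j c 0 j *: f j))^T.
Proof.
apply/rowP => a; rewrite !mxE mcoeff_lin.
by apply: eq_bigr => j _; rewrite mxE.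
Qed.

Lemma coef_vec_inj (p q : P) : p \is d.-homog -> q \is d.-homog ->
  coef_vec mon p = coef_vec mon q -> p = q.
Proof.
move=> hp hq pq; apply/mpolyP => m.
have [md|md] := eqVneq (mdeg m) d; last by rewrite !(dhomog_nemf_coeff _ md).
have /tnthP[a ->] : m \in mon by rewrite mon_ord.2 md.
by have /colP/(_ a) := pq; rewrite !mxE.
Qed.

Lemma coef_vec_submx (p : P) : p \is d.-homog ->
  ((coef_vec mon p)^T <= basis_mx)%MS <->
  exists c : 'rV_k, p = \sum_j c 0 j *: f j.
Proof.
move=> hp; split=> [/submxP [c]|[c ->]]; last by rewrite -mul_basis_mx submxMl.
rewrite mul_basis_mx => /trmx_inj h; exists c.
apply: coef_vec_inj h => //; apply: rpred_sum => j _.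
exact/rpredZ/f_homog.
Qed.

(** Appending a row to a matrix keeps the rank if and only if the row belongs to
    the row space. *)
Lemma rank_basis_action_mx (g : 'M[Cplx R]_n) i :
  row_free basis_mx ->
  \rank (basis_action_mx mon f g i) = k <->
  exists c : 'rV_k, lie_deriv g (f i) = \sum_j c 0 j *: f j.
Proof.
move=> /eqP free; rewrite -coef_vec_submx; last exact: lie_deriv_homog.
have -> : basis_action_mx mon f g i =
    (col_mx basis_mx (coef_vec mon (lie_deriv g (f i)))^T)^T.
  rewrite tr_col_mx trmxK /basis_action_mx lie_actE; congr row_mx.
  by apply/matrixP => a j; rewrite !mxE.
set u := (coef_vec _ _)^T; rewrite mxrank_tr -addsmxE -[X in _ = X <-> _]free.
have [_ eq_rank] := mxrank_leqif_sup (addsmxSl basis_mx u).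
have -> : (u <= basis_mx)%MS = (basis_mx + u <= basis_mx)%MS.
  by rewrite addsmx_sub submx_refl.
by rewrite -eq_rank eq_sym; split=> /eqP.
Qed.

End CoefficientRows.

(** * Orbits of a form under a one-parameter group *)

Section OneParameterGroup.
Variables (R : realType) (n d : nat).
Local Notation P := {mpoly (Cplx R)[n]}.
Local Notation M := 'M[Cplx R]_n.

(** For each monomial, the column of its coefficients in the polynomials
    [gl_act (expmx (t g)) (f j)] solves the linear system with matrix [B]. *)
Lemma gl_act_expmx_span k (f : 'I_k -> P) (g : M) (B : 'M[Cplx R]_k) t i :
  (forall i, lie_deriv g (f i) = \sum_j B i j *: f j) ->
  gl_act (expmx (of_real t *: g)) (f i) =
    \sum_j expmx (of_real t *: B) i j *: f j.
Proof.
move=> hB; apply/mpolyP => m.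
pose Y s : 'cV[Cplx R]_k := \col_j (gl_act (expmx (of_real s *: g)) (f j))@_m.
have -> : (gl_act (expmx (of_real t *: g)) (f i))@_m = Y t i 0 by rewrite mxE.
rewrite (@linear_ode_unique _ _ _ B) => [|s j l].
  rewrite mxE mcoeff_lin; apply: eq_bigr => j _.
  by rewrite mxE gl_act_expmx0.
have -> : (B *m Y s) j l =
    (gl_act (expmx (of_real s *: g)) (lie_deriv g (f j)))@_m.
  rewrite mxE hB gl_act_sum [RHS]mcoeff_lin.
  by apply: eq_bigr => j' _; rewrite mxE.
have := is_pderive_gl_act g (f j) s m.
by congr is_cderive; apply/funext => u; rewrite mxE.
Qed.

(** The span is the kernel of the cokernel matrix [K] of the coefficient rows, and
    a curve annihilated by [K] has its derivative annihilated by [K]. *)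
Lemma span_of_gl_act (mon : 'C((n + d - 1)%N, d).-tuple 'X_{1..n})
  (mon_ord : monomial_ordering mon) k (f : 'I_k -> P) (g : M) p :
  (forall i, f i \is d.-homog) -> p \is d.-homog ->
  (forall t : R, exists c : 'rV_k,
    gl_act (expmx (of_real t *: g)) p = \sum_j c 0 j *: f j) ->
  exists c : 'rV_k, lie_deriv g p = \sum_j c 0 j *: f j.
Proof.
move=> fh ph H; apply/(coef_vec_submx mon_ord fh); first exact: lie_deriv_homog.
rewrite submxE; set K := cokermx _.
pose U (s : R) := (coef_vec mon (gl_act (expmx (of_real s *: g)) p))^T.
have dU : is_mderive U 0 (coef_vec mon (lie_deriv g p))^T.
  move=> i a; have := is_pderive_gl_act0 g p (tnth mon a); rewrite !mxE.
  by congr is_cderive; apply/funext => s; rewrite !mxE.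
have UK s : U s *m K = 0.
  apply/eqP; rewrite -submxE; apply/(coef_vec_submx mon_ord fh) => //.
  exact: gl_act_homog.
have dUK := is_mderiveM dU (is_mderive_cst K 0).
rewrite [X in _ + X]mulmx0 addr0 in dUK.
apply/eqP/matrixP => i j; rewrite [RHS]mxE.
apply: is_cderive_unique (dUK i j) _.
rewrite (_ : (fun s => _) = (fun=> 0)); first exact: is_cderive_cst.
by apply/funext => s; rewrite UK mxE.
Qed.

End OneParameterGroup.

Unset Implicit Arguments.

Theorem theorem2 (R : realType) (n d : nat)
  (I : prime_idealr {mpoly (Cplx R)[n]})
  (Ihomog : homogeneous_ideal I)
  (Igen : generated_in_degree_le d I)
  (mon : 'C((n + d - 1)%N, d).-tuple 'X_{1..n})
  (mon_ord : monomial_ordering mon)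
  (k : nat) (f : 'I_k -> {mpoly (Cplx R)[n]})
  (fbasis : is_basis f (graded_component I d)) :
  symmetry_lie_algebra I =
    [set g : 'M[Cplx R]_n |
       forall i : 'I_k, \rank (basis_action_mx mon f g i) = k].
Proof.
case: fbasis => fI f_free f_span.
have fh i : f i \is d.-homog by have [] := fI i.
have free : row_free (basis_mx mon f).
  rewrite -kermx_eq0; apply/rowV0P => v /sub_kermxP; rewrite mul_basis_mx.
  move=> /(congr1 trmx); rewrite trmxK trmx0 => vf.
  apply/rowP => j; rewrite mxE.
  apply: (f_free (fun j => v 0 j)); apply: (coef_vec_inj mon_ord).
  - by apply: rpred_sum => l _; apply/rpredZ/fh.
  - exact: rpred0.
  - by rewrite vf; apply/colP => a; rewrite !mxE mcoeff0.
have span p : p \in I -> p \is d.-homog ->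
    exists c : 'rV_k, p = \sum_j c 0 j *: f j.
  move=> pI ph; have [c ->] := f_span p (conj pI ph).
  by exists (\row_j c j); apply: eq_bigr => j _; rewrite mxE.
apply/seteqP; split=> g /= hg.
  move=> i; apply/(rank_basis_action_mx mon_ord fh) => //.
  apply: (span_of_gl_act mon_ord) => // t.
  by apply: span; [apply: (hg t).2; case: (fI i)|apply: gl_act_homog].
have /fin_all_exists [b hb] i :
  exists c : 'rV_k, lie_deriv g (f i) = \sum_j c 0 j *: f j.
  by apply/(rank_basis_action_mx mon_ord fh).
have hB i :
    lie_deriv g (f i) = \sum_j (\matrix_(i, j) b i 0 j) i j *: f j.
  by rewrite hb; apply: eq_bigr => j _; rewrite mxE.
move=> t; split; first exact: expmx_unit.
apply: (lin_subst_ideal Ihomog Igen) => p pI /(span p pI)[c ->].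
rewrite [lin_subst _ _]raddf_sum; apply: rpred_sum => i _ /=.
rewrite [X in X \in _]linearZ /=; apply: idealZr.
have := gl_act_expmx_span t i hB; rewrite /gl_act /lin_subst => ->.
by apply: rpred_sum => j _; apply: idealZr; case: (fI j).
Qed.
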